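(* Let $\sigma>0$ and let $\varphi_L(t,\sigma)=\dfrac{\sigma^2}{\sigma^2+t^2}$, $t\in\mathbb{R}$. Then the family of integer shifts $\{\varphi_L(\cdot-k,\sigma)\}_{k\in\mathbb{Z}}$ is a Riesz system in $L_2(\mathbb{R})$, and its lower Riesz constant $A_L(\sigma)$ and upper Riesz constant $B_L(\sigma)$ are $$A_L(\sigma)=\frac{\sigma^{2}\pi^{2}}{\sinh(2\sigma\pi)},\qquad B_L(\sigma)=\frac{\sigma^{2}\pi^{2}\cosh(2\sigma\pi)}{\sinh(2\sigma\pi)}.$$
   Context: A family of functions $\varphi_k\in L_2(\mathbb{R})$, $k\in\mathbb{Z}$, is called a Riesz system if there exist constants $A,B>0$ such that for every sequence $c=(c_k)_{k\in\mathbb{Z}}\in \ell_2$ $$A\|c\|_{\ell_2}^2\le\Big\|\sum_{k=-\infty}^{\infty}c_k\varphi_k\Big\|_{L_2(\mathbb{R})}^2\le B\|c\|_{\ell_2}^2.$$ The largest admissible $A$ is called the lower Riesz constant and the smallest admissible $B$ the upper Riesz constant. The $L_2(\mathbb{R})$ norm is taken with respect to Lebesgue measure $dt$. *)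

(* Defs.v *)
From HB Require Import structures.
From mathcomp Require Import all_boot all_order all_algebra.
From mathcomp Require Import all_classical all_reals all_analysis.
From mathcomp Require Import complex.

Set Implicit Arguments.
Unset Strict Implicit.
Unset Printing Implicit Defensive.

Import Order.TTheory GRing.Theory Num.Theory.
Import numFieldNormedType.Exports.

Local Open Scope classical_set_scope.
Local Open Scope ring_scope.
Local Open Scope complex_scope.

Local Notation normc := ComplexField.Normc.normc.

Definition sinh (R : realType) (x : R) : R := (expR x - expR (- x)) / 2.

Definition cosh (R : realType) (x : R) : R := (expR x + expR (- x)) / 2.

(* The scalars are complex. The library has no Lp spaces of complex-valued
   functions, so membership in L_2(R) is tested on real and imaginary parts,
   and the norm is the library's 2-norm of the modulus. *)
Definition L2 (R : realType) : set (R -> R[i]) :=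
  [set f | (fun x => complex.Re (f x)) \in Lfun (@lebesgue_measure R) 2%:E /\
           (fun x => complex.Im (f x)) \in Lfun (@lebesgue_measure R) 2%:E].

Definition L2norm (R : realType) (f : R -> R[i]) : \bar R :=
  ('N[@lebesgue_measure R]_2%:E [(fun x => (normc (f x))%:E)])%E.

Definition sqnorm_ell2 (R : realType) (c : int -> R[i]) : \bar R :=
  \esum_(k in [set: int]) ((normc (c k)) ^+ 2)%:E.

Definition ell2 (R : realType) : set (int -> R[i]) :=
  [set c | (sqnorm_ell2 c < +oo)%E].

(* \sum_(-m <= k < n) c_k phi_k ; note that Negz k = - (k + 1) *)
Definition partial_sum (R : realType) (phi : int -> R -> R[i])
    (c : int -> R[i]) (m n : nat) (x : R) : R[i] :=
  \sum_(k < m) c (Negz k) * phi (Negz k) x +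
  \sum_(k < n) c (Posz k) * phi (Posz k) x.

(* f = \sum_(k in Z) c_k phi_k in L_2(R): both ends of the two-sided series
   tend to infinity independently *)
Definition is_L2_sum (R : realType) (phi : int -> R -> R[i])
    (c : int -> R[i]) (f : R -> R[i]) : Prop :=
  L2 f /\
  (fun mn : nat * nat =>
     L2norm (fun x => f x - partial_sum phi c mn.1 mn.2 x)) @ (\oo, \oo)
    --> 0%E.

Definition riesz_bounds (R : realType) (phi : int -> R -> R[i]) (A B : R)
    : Prop :=
  forall c : int -> R[i], ell2 c ->
    exists f : R -> R[i], [/\ is_L2_sum phi c f,
      (A%:E * sqnorm_ell2 c <= L2norm f ^+ 2)%E &
      (L2norm f ^+ 2 <= B%:E * sqnorm_ell2 c)%E].

Definition riesz_system (R : realType) (phi : int -> R -> R[i]) : Prop :=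
  (forall k : int, L2 (phi k)) /\
  exists A B : R, [/\ 0 < A, 0 < B & riesz_bounds phi A B].

Definition lower_admissible (R : realType) (phi : int -> R -> R[i]) : set R :=
  [set A | 0 < A /\ exists2 B : R, 0 < B & riesz_bounds phi A B].

Definition upper_admissible (R : realType) (phi : int -> R -> R[i]) : set R :=
  [set B | 0 < B /\ exists2 A : R, 0 < A & riesz_bounds phi A B].

Definition is_lower_riesz_constant (R : realType) (phi : int -> R -> R[i])
    (A : R) : Prop :=
  lower_admissible phi A /\ ubound (lower_admissible phi) A.

Definition is_upper_riesz_constant (R : realType) (phi : int -> R -> R[i])
    (B : R) : Prop :=
  upper_admissible phi B /\ lbound (upper_admissible phi) B.

Definition lorentz (R : realType) (t sigma : R) : R :=
  sigma ^+ 2 / (sigma ^+ 2 + t ^+ 2).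

Definition lorentz_shifts (R : realType) (sigma : R) (k : int) (t : R) : R[i] :=
  (lorentz (t - k%:~R) sigma)%:C.

(* Main.v *)
Require Import Defs.
From mathcomp Require Import all_boot all_order all_algebra.
From mathcomp Require Import all_classical all_reals all_analysis.
From mathcomp Require Import measurable_realfun complex ring lra zify.

Set Implicit Arguments.
Unset Strict Implicit.
Unset Printing Implicit Defensive.

Import Order.TTheory GRing.Theory Num.Theory.
Import numFieldNormedType.Exports.

Local Open Scope classical_set_scope.
Local Open Scope ring_scope.

(** For a finite real sequence a the squared norm of
\sum_k a_k lorentz (x - k) is the Toeplitz form \sum_(j, k) a_j a_k g(j - k)
of the Gram kernel g(m) = 2 pi sigma^3 / (4 sigma^2 + m^2), up to a factor a
convolution of two Cauchy densities ([integral_lorentzM]).  Up to the sign (-1)^m, g(m) is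
the cosine moment (1/pi) \int_0^pi w(u) cos(m u) du of

  w(u) = A cosh(2 sigma u),   A = sigma^2 pi^2 / sinh(2 sigma pi)

([cosine_moments_lorentz]), the sign being absorbed by a_k -> (-1)^k a_k.
The Toeplitz form is thus the mean of w against the nonnegative function
|\sum_k (-1)^k a_k e^{iku}|^2, so it lies between the minimum A of w on
[0, pi], reached at 0, and its maximum A cosh(2 sigma pi), reached at pi,
times \sum_k a_k^2 ([lorentz_gram_bounds]).  Complex coefficients follow by
splitting into real and imaginary parts, the generator being real.

The positivity that this needs, [toeplitz_ge0], takes no integration: an
explicit antiderivative of each w(u) cos(m u) makes the form the increment of
a function with nonnegative derivative.

The bounds are optimal because w may be tested against Fejer kernels: for
v = 0 or pi, the sequences (-1)^k cos(k v), 0 <= k < N, concentrate the mass N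
of |\sum_k (-1)^k a_k e^{iku}|^2 at u = v.  Quantitatively
|w(u) - w(v)| <= e + C (1 - cos(u - v)), and the form of 1 - cos(u - v)
stays bounded by 1 on these sequences, whence the Rayleigh quotient tends to
w(v) ([toeplitz_asymptotics], [lorentz_gram_sharp]).

It remains to sum the series for c in ell_2.  Since lorentz (x - k) decays
like k^-2, the series converges at every point, and Fatou's lemma applied to
differences of partial sums bounds the squared L_2 distance of the sum to a
partial sum by the upper constant times the ell_2 tail ([energy_tail]).  This
gives both the convergence in L_2 and the passage of the two bounds to the
limit ([lorentz_riesz_bounds]).  For finitely supported c every L_2 sum agrees
in norm with the finite one ([finite_riesz_bounds]), so the test sequences
above do constrain all admissible constants. *)

(** * Cosine moments and positive Toeplitz forms *)

Section Trig.
Variable R : realType.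
Implicit Types (a u v : R) (w : R -> R) (mu : int -> R) (s : seq int).

Lemma derive_sum_seq (I : Type) (s : seq I) (F f : I -> R -> R) (u : R) :
  (forall i, is_derive u 1 (F i) (f i u)) ->
  is_derive u 1 (fun x => \sum_(i <- s) F i x) (\sum_(i <- s) f i u).
Proof.
move=> dF; elim: s => [|i s IHs].
  have -> : (fun x => \sum_(i <- [::]) F i x) = cst 0.
    by apply/funext => x; rewrite big_nil.
  by rewrite big_nil; exact: is_derive_cst.
have -> : (fun x => \sum_(j <- i :: s) F j x) =
    F i + (fun x => \sum_(j <- s) F j x).
  by apply/funext => x; rewrite big_cons.
by rewrite big_cons; exact: is_deriveD.
Qed.

Lemma is_deriveMl (k u df : R) (f : R -> R) :
  is_derive u 1 f df -> is_derive u 1 (fun x => k * f x) (k * df).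
Proof. by move=> dF; exact: (@is_deriveZ R R R f k u 1 df). Qed.

Lemma is_derive_argMl (k u df : R) (f : R -> R) :
  is_derive (k * u) 1 f df -> is_derive u 1 (fun x => f (k * x)) (k * df).
Proof.
move=> dF; have dk : is_derive u 1 (fun x => k * x) (k * 1).
  exact: is_deriveMl.
apply: (@is_derive_eq _ _ _ _ _ _ _ _ (is_derive1_comp dF dk)).
by rewrite mulr1 mulrC.
Qed.

(** The values [mu m] are the moments (1/pi) \int_0^pi w(u) cos(m u) du, encoded
by antiderivatives so that linear operations on [w] need no integrability. *)
Definition cosine_moments w mu := exists W : int -> R -> R,
  (forall m u, is_derive u 1 (W m) (w u * cos (m%:~R * u))) /\
  (forall m, W m pi - W m 0 = pi * mu m).

Definition toeplitz mu s (c : int -> R) : R :=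
  \sum_(j <- s) \sum_(k <- s) c j * c k * mu (j - k).

(** The form is 1/pi times the increment over [0, pi] of a function whose
derivative is w(u) |\sum_k c_k e^{iku}|^2. *)
Lemma toeplitz_ge0 w mu s c : cosine_moments w mu ->
  (forall u, 0 <= u <= pi -> 0 <= w u) -> 0 <= toeplitz mu s c.
Proof.
move=> [W [dW Wmu]] w0.
pose G u := \sum_(j <- s) \sum_(k <- s) c j * c k * W (j - k) u.
pose g u := \sum_(j <- s) \sum_(k <- s)
  c j * c k * (w u * cos ((j - k)%:~R * u)).
have dG u : is_derive u 1 G (g u).
  apply: (@derive_sum_seq _ s
    (fun j x => \sum_(k <- s) c j * c k * W (j - k) x)
    (fun j x => \sum_(k <- s) c j * c k * (w x * cos ((j - k)%:~R * x)))) => j.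
  apply: (@derive_sum_seq _ s (fun k x => c j * c k * W (j - k) x)
    (fun k x => c j * c k * (w x * cos ((j - k)%:~R * x)))) => k.
have gE u : g u = w u * ((\sum_(j <- s) c j * cos (j%:~R * u)) ^+ 2 +
                         (\sum_(j <- s) c j * sin (j%:~R * u)) ^+ 2).
  rewrite /g !expr2 !mulr_suml -big_split mulr_sumr; apply: eq_bigr => j _.
  rewrite !mulr_sumr -big_split mulr_sumr; apply: eq_bigr => k _ /=.
  by rewrite intrD rmorphN /= mulrBl cosB; ring.
have -> : toeplitz mu s c = (G pi - G 0) / pi.
  rewrite -sumrB mulr_suml; apply: eq_bigr => j _.
  rewrite -sumrB mulr_suml; apply: eq_bigr => k _.
  by rewrite -mulrBr Wmu mulrCA [RHS]mulrAC divff ?mul1r// lt0r_neq0 ?pi_gt0.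
have cG : {within `[0, pi], continuous G}.
  by apply: derivable_within_continuous => x _; exact: ex_derive.
have [x xpi ->] := MVT_segment (pi_ge0 R) (fun x _ => dG x) cG.
rewrite subr0 mulfK ?gt_eqF ?pi_gt0// gE mulr_ge0 ?addr_ge0 ?sqr_ge0//.
by apply: w0; move: xpi; rewrite in_itv.
Qed.

Lemma cosine_momentsD w1 mu1 w2 mu2 :
  cosine_moments w1 mu1 -> cosine_moments w2 mu2 ->
  cosine_moments (fun u => w1 u + w2 u) (fun m => mu1 m + mu2 m).
Proof.
move=> [W1 [dW1 W1E]] [W2 [dW2 W2E]]; exists (fun m => W1 m + W2 m).
split=> [m u|m]; first by rewrite mulrDl; exact: is_deriveD.
by rewrite mulrDr -W1E -W2E !fctE; ring.
Qed.

Lemma cosine_momentsZ b w mu : cosine_moments w mu ->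
  cosine_moments (fun u => b * w u) (fun m => b * mu m).
Proof.
move=> [W [dW WE]]; exists (fun m u => b * W m u).
split=> [m u|m]; first by rewrite -mulrA; exact: is_deriveMl.
by rewrite /= [RHS]mulrCA -WE; ring.
Qed.

(** Product-to-sum: cos u cos(m u) is the half-sum of cos((m + 1) u) and
cos((m - 1) u). *)
Lemma cosine_momentsM_cos w mu : cosine_moments w mu ->
  cosine_moments (fun u => w u * cos u)
                 (fun m => 2^-1 * (mu (m + 1) + mu (m - 1))).
Proof.
move=> [W [dW WE]].
exists (fun m u => 2^-1 * (W (m + 1) u + W (m - 1) u)); split=> [m u|m]; last first.
  by rewrite /= [RHS]mulrCA [pi * _]mulrDr -!WE; ring.
have -> : w u * cos u * cos (m%:~R * u) = 2^-1 *
    (w u * cos ((m + 1)%:~R * u) + w u * cos ((m - 1)%:~R * u)).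
  rewrite !intrD rmorphN /= mulrDl mulrBl mul1r cosB cosD; by field.
exact: (is_deriveMl 2^-1 (is_deriveD (dW (m + 1) u) (dW (m - 1) u))).
Qed.

Lemma sin_int (v : R) (k : int) : sin v = 0 -> sin (k%:~R * v) = 0.
Proof.
move=> sv; have natk n : sin (n%:R * v) = 0.
  elim: n => [|n IHn]; first by rewrite mul0r sin0.
  by rewrite -natr1 mulrDl mul1r sinD IHn sv mul0r mulr0 addr0.
by case: k => n; [exact: natk|rewrite NegzE rmorphN /= mulNr sinN natk oppr0].
Qed.

(** The characters m |-> cos(m v) with sin v = 0, that is 1 and (-1)^m; they
twist Toeplitz forms without changing the squares of the coefficients. *)
Lemma cos_intB (v : R) (j k : int) : sin v = 0 ->
  cos ((j - k)%:~R * v) = cos (j%:~R * v) * cos (k%:~R * v).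
Proof.
by move=> sv; rewrite intrD rmorphN/= mulrBl cosB !sin_int// mulr0 addr0.
Qed.

Lemma cos_int_sqr (v : R) (k : int) : sin v = 0 -> cos (k%:~R * v) ^+ 2 = 1.
Proof. by move=> sv; rewrite expr2 -cos_intB// subrr mul0r cos0. Qed.

Definition kronecker (m : int) : R := (m == 0)%:R.

Lemma cosine_moments1 : cosine_moments (fun=> 1) kronecker.
Proof.
exists (fun m u => if m == 0 then u else m%:~R^-1 * sin (m%:~R * u)).
split=> [m u|m]; rewrite /kronecker; case: eqP => [m0|/eqP m0].
- by rewrite m0 mul0r cos0 mulr1; exact: is_derive_id.
- have mR : m%:~R != 0 :> R by rewrite intr_eq0.
  apply: (is_derive_eq (is_deriveMl m%:~R^-1
    (is_derive_argMl (is_derive_sin (m%:~R * u))))).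
  by field.
- by rewrite subr0 mulr1.
- by rewrite sin_int ?sinpi// !mulr0 sin0 mulr0 subrr.
Qed.

Lemma is_derive_sinh (x : R) : is_derive x 1 (@sinh R) (cosh x).
Proof.
have dexpN := is_derive1_comp (is_derive_expR (- x)) (is_deriveNid x 1).
have dE := is_deriveM (is_deriveB (is_derive_expR x) dexpN)
  (is_derive_cst (2^-1 : R) x 1).
by apply: (is_derive_eq dE); rewrite /sinh /cosh /GRing.scale/= fctE; ring.
Qed.

Lemma is_derive_cosh (x : R) : is_derive x 1 (@cosh R) (sinh x).
Proof.
have dexpN := is_derive1_comp (is_derive_expR (- x)) (is_deriveNid x 1).
have dE := is_deriveM (is_deriveD (is_derive_expR x) dexpN)
  (is_derive_cst (2^-1 : R) x 1).
by apply: (is_derive_eq dE); rewrite /sinh /cosh /GRing.scale/= fctE; ring.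
Qed.

Lemma cosine_moments_cosh a : 0 < a ->
  cosine_moments (fun u => cosh (a * u)) (fun m =>
    cos (m%:~R * pi) * a * sinh (a * pi) / (pi * (a ^+ 2 + m%:~R ^+ 2))).
Proof.
move=> a0; exists (fun m u => (a ^+ 2 + m%:~R ^+ 2)^-1 *
  (a * (sinh (a * u) * cos (m%:~R * u)) +
   m%:~R * (cosh (a * u) * sin (m%:~R * u)))).
have am0 (m : int) : a ^+ 2 + m%:~R ^+ 2 != 0 :> R.
  by rewrite gt_eqF// ltr_pwDl ?sqr_ge0// exprn_gt0.
split=> [m u|m].
  have dsh := is_derive_argMl (is_derive_sinh (a * u)).
  have dch := is_derive_argMl (is_derive_cosh (a * u)).
  have dcos := is_derive_argMl (is_derive_cos (m%:~R * u)).
  have dsin := is_derive_argMl (is_derive_sin (m%:~R * u)).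
  apply: (is_derive_eq (is_deriveMl _ (is_deriveD
    (is_deriveMl a (is_deriveM dsh dcos))
    (is_deriveMl m%:~R (is_deriveM dch dsin))))).
  by rewrite /GRing.scale/=; field.
rewrite !mulr0 sin_int ?sinpi// sin0 !mulr0 !addr0.
have -> : sinh 0 = 0 :> R by rewrite /sinh oppr0 subrr mul0r.
move: (am0 m) (lt0r_neq0 (pi_gt0 R)); move: pi => p am p0.
by field; rewrite am p0.
Qed.
End Trig.

(** * Bounds and asymptotics of Toeplitz forms *)

Section Toeplitz.
Variable R : realType.
Implicit Types (a u v : R) (w : R -> R) (mu : int -> R) (s : seq int).

Lemma toeplitzD mu1 mu2 s (c : int -> R) :
  toeplitz (fun m => mu1 m + mu2 m) s c = toeplitz mu1 s c + toeplitz mu2 s c.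
Proof.
rewrite /toeplitz -big_split; apply: eq_bigr => j _.
by rewrite -big_split; apply: eq_bigr => k _; rewrite /= mulrDr.
Qed.

Lemma toeplitzZ b mu s (c : int -> R) :
  toeplitz (fun m => b * mu m) s c = b * toeplitz mu s c.
Proof.
rewrite /toeplitz mulr_sumr; apply: eq_bigr => j _.
by rewrite mulr_sumr; apply: eq_bigr => k _; rewrite mulrCA.
Qed.

Lemma toeplitz_kronecker s (c : int -> R) : uniq s ->
  toeplitz (@kronecker R) s c = \sum_(k <- s) c k ^+ 2.
Proof.
move=> us; rewrite /toeplitz big_seq [RHS]big_seq; apply: eq_bigr => j js.
rewrite (bigD1_seq j)//= subrr /kronecker eqxx mulr1 -expr2 big1 ?addr0// => k.
by rewrite eq_sym -subr_eq0 => /negbTE ->; rewrite mulr0.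
Qed.

(** Positivity for w - lo and hi - w, whose constant parts contribute the sum of
squares. *)
Lemma toeplitz_bounds w mu lo hi s (c : int -> R) : cosine_moments w mu ->
  (forall u, 0 <= u <= pi -> lo <= w u <= hi) -> uniq s ->
  lo * (\sum_(k <- s) c k ^+ 2) <= toeplitz mu s c
    <= hi * (\sum_(k <- s) c k ^+ 2).
Proof.
move=> wmu wb us; set S := \sum_(k <- s) _; set T := toeplitz _ _ _.
have lower : 0 <= T + - lo * S.
  rewrite /S -toeplitz_kronecker// -toeplitzZ -toeplitzD.
  apply: toeplitz_ge0 (cosine_momentsD wmu
    (cosine_momentsZ (- lo) (cosine_moments1 R))) _ => u /wb/andP[? ?].
  by lra.
have upper : 0 <= -1 * T + hi * S.
  rewrite /S -toeplitz_kronecker// -!toeplitzZ -toeplitzD.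
  apply: toeplitz_ge0 (cosine_momentsD (cosine_momentsZ (-1) wmu)
    (cosine_momentsZ hi (cosine_moments1 R))) _ => u /wb/andP[? ?].
  by lra.
by apply/andP; split; lra.
Qed.

Definition initial_ints N : seq int := [seq Posz k | k <- index_iota 0 N].

Lemma uniq_initial_ints N : uniq (initial_ints N).
Proof. by rewrite map_inj_uniq ?iota_uniq// => i j []. Qed.

Lemma sum_superdiagonal N :
  \sum_(j < N) \sum_(k < N) (k == j.+1 :> nat)%:R = N.-1%:R :> R.
Proof.
rewrite exchange_big /=.
have inner (k : 'I_N) :
    \sum_(j < N) (k == j.+1 :> nat)%:R = (0 < k)%N%:R :> R.
  case: k => -[|k] kN /=; first by rewrite big1.
  rewrite (bigD1 (Ordinal (ltnW kN)))//= eqxx big1 ?addr0// => j jk.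
  by rewrite eqSS eq_sym -(inj_eq val_inj) in jk *; rewrite (negbTE jk).
under eq_bigr do rewrite inner.
case: N {inner} => [|N]; first by rewrite big_ord0.
rewrite big_ord_recl add0r (eq_bigr (fun=> 1))//.
by rewrite sumr_const card_ord.
Qed.

(** The moments of 1 - cos(u - v) when sin v = 0. *)
Let fejer v m : R := kronecker R m +
  (- cos v) * (2^-1 * (kronecker R (m + 1) + kronecker R (m - 1))).

(** On c_k = cos(k v) the diagonal contributes N, and each of the two adjacent
diagonals removes (N - 1)/2. *)
Lemma toeplitz_fejer v N : sin v = 0 ->
  toeplitz (fejer v) (initial_ints N) (fun k => cos (k%:~R * v)) <= 1.
Proof.
move=> sv; have uN := uniq_initial_ints N.
have cv : cos v * cos v = 1.
  by have := cos_int_sqr 1 sv; rewrite mul1r expr2.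
rewrite toeplitzD toeplitzZ toeplitzZ toeplitzD toeplitz_kronecker//.
rewrite (eq_bigr (fun=> 1)) => [|k _]; last exact: cos_int_sqr.
rewrite /toeplitz /initial_ints !big_map.
have -> : \sum_(0 <= k < N) 1 = N%:R :> R by rewrite sumr_const_nat subn0.
have diag (d : int) : (d == 1) || (d == -1) ->
    \sum_(0 <= j < N) \sum_(k <- [seq Posz k | k <- index_iota 0 N])
      cos (j%:~R * v) * cos (k%:~R * v) * kronecker R (j%:Z - k + d)
    = cos v * N.-1%:R.
  move=> d1; rewrite big_mkord.
  have cd : cos (d%:~R * v) = cos v.
    by case/orP: d1 => /eqP ->; rewrite ?mul1r// mulN1r cosN.
  transitivity (\sum_(j < N) \sum_(k < N)
      cos v * ((j%:Z - k%:Z + d == 0)%:R : R)).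
    apply: eq_bigr => j _; rewrite big_map big_mkord; apply: eq_bigr => k _.
    rewrite /kronecker; case: eqP => [jk|_]; last by rewrite !mulr0.
    rewrite -cos_intB//; suff -> : j%:Z - k%:Z = - d by rewrite rmorphN/= mulNr cosN cd.
    by apply/eqP; rewrite -subr_eq0 opprK jk.
  under eq_bigr do rewrite -mulr_sumr.
  rewrite -mulr_sumr; congr (_ * _); rewrite -sum_superdiagonal.
  case/orP: d1 => /eqP ->; last rewrite exchange_big /=; apply: eq_bigr => j _;
    by apply: eq_bigr => k _; congr (nat_of_bool _)%:R; lia.
rewrite !diag//; have -> : N%:R + - cos v * (2^-1 * (cos v * N.-1%:R +
    cos v * N.-1%:R)) = N%:R - (cos v * cos v) * N.-1%:R by field.
rewrite cv mul1r; case: N {uN diag} => [|N] /=; first by rewrite subrr.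
by rewrite -natr1; lra.
Qed.

(** Near v the continuity of w supplies e; away from v the function
1 - cos(u - v) is bounded below, and C is large enough to dominate the
oscillation M of w.
When sin v = 0, cos(u - v) is cos u cos v. *)
Lemma cosine_majorant w v M e : sin v = 0 -> 0 <= v <= pi ->
  (forall u, 0 <= u <= pi -> `|w u - w v| <= M) -> continuous w -> 0 < e ->
  exists2 C, 0 <= C & forall u, 0 <= u <= pi ->
    `|w u - w v| <= e + C * (1 - cos u * cos v).
Proof.
move=> sv /andP[v0 vpi] wM cw e0.
have /cvgrPdist_le/(_ e e0)[d /= d0 dP] := cw v.
pose d' := Num.min d pi.
have d'0 : 0 < d' by rewrite lt_min d0 pi_gt0.
have d'pi : d' <= pi by rewrite ge_min lexx orbT.
have cd1 : 0 < 1 - cos d'.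
  by rewrite subr_gt0 -[ltRHS]cos0 ltr_cos ?in_itv/= ?lexx ?pi_ge0// ltW.
have M0 : 0 <= M by apply: le_trans (wM v _); rewrite ?v0.
exists (M / (1 - cos d')) => [|u /andP[u0 upi]]; first by rewrite divr_ge0// ltW.
have cuv : cos u * cos v = cos `|u - v|.
  by case: (ger0P (u - v)) => _; rewrite ?cosN cosB sv mulr0 addr0.
have [uv|uv] := ltP `|u - v| d'.
  rewrite (@le_trans _ _ e)//.
    rewrite distrC; apply: dP; rewrite /= distrC.
    by rewrite (lt_le_trans uv)// ge_min lexx.
  by rewrite lerDl mulr_ge0 ?divr_ge0 ?(ltW cd1)// cuv subr_ge0 cos_le1.
rewrite (@le_trans _ _ M) ?wM ?u0//.
rewrite -[leLHS]add0r lerD ?(ltW e0)// mulrAC ler_pdivlMr// ler_wpM2l//.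
rewrite lerD2l lerN2 cuv.
have uvpi : `|u - v| <= pi by rewrite ler_norml; apply/andP; split; lra.
by rewrite leNgt ltr_cos -?leNgt ?in_itv/= ?normr_ge0 ?uvpi ?d'pi ?(ltW d'0).
Qed.

(** Positivity applied to e + C (1 - cos(u - v)) - |w(u) - w(v)|, one sign at a
time, where the Fejer part contributes at most C. *)
Lemma toeplitz_asymptotics w mu v M e : cosine_moments w mu ->
  sin v = 0 -> 0 <= v <= pi ->
  (forall u, 0 <= u <= pi -> `|w u - w v| <= M) -> continuous w -> 0 < e ->
  exists C, forall N,
    `|toeplitz mu (initial_ints N) (fun k => cos (k%:~R * v)) - w v * N%:R|
      <= e * N%:R + C.
Proof.
move=> wmu sv vpi wM cw e0.
have [C C0 CP] := cosine_majorant sv vpi wM cw e0.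
exists C => N; set s := initial_ints N; set c := fun k : int => cos _.
have fejerP : cosine_moments (fun u => 1 + - cos v * (1 * cos u)) (fejer v).
  exact: cosine_momentsD (cosine_moments1 R) (cosine_momentsZ (- cos v)
    (cosine_momentsM_cos (cosine_moments1 R))).
(* b = 1 and b = -1 give the two halves of the absolute value *)
have key (b : R) : `|b| = 1 ->
    0 <= b * (toeplitz mu s c - w v * N%:R) + (e * N%:R + C).
  move=> b1; have := toeplitz_ge0 s c (cosine_momentsD (cosine_momentsZ b wmu)
    (cosine_momentsD (cosine_momentsZ (e - b * w v) (cosine_moments1 R))
      (cosine_momentsZ C fejerP))).
  rewrite !toeplitzD !toeplitzZ toeplitz_kronecker ?uniq_initial_ints//.
  rewrite (eq_bigr (fun=> 1)) => [|k _]; last exact: cos_int_sqr.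
  rewrite big_map sumr_const_nat subn0 => H.
  have /le_trans : 0 <= b * toeplitz mu s c + ((e - b * w v) * N%:R +
      C * toeplitz (fejer v) s c).
    apply: H => u u0; have := CP u u0.
    have : - (b * (w u - w v)) <= `|w u - w v|.
      by rewrite -[leRHS]mul1r -b1 -normrM -normrN ler_norm.
    by lra.
  apply; have : C * toeplitz (fejer v) s c <= C * 1.
    by rewrite ler_wpM2l// toeplitz_fejer.
  by lra.
have := key 1 (normr1 R); have := key (-1); rewrite normrN normr1 => /(_ erefl).
by rewrite ler_norml => *; apply/andP; split; lra.
Qed.
End Toeplitz.

(** * The Gram kernel of the Lorentz function *)

Section LorentzGram.
Variable R : realType.
Variable sigma : R.
Hypothesis sigma_gt0 : 0 < sigma.
Let A : R := sigma ^+ 2 * pi ^+ 2 / sinh (2 * sigma * pi).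

(** The difference cosh y - cosh x factors as (e^y - e^x)(1 - e^(-x-y)) / 2. *)
Lemma ler_cosh (x y : R) : 0 <= x <= y -> cosh x <= cosh y.
Proof.
move=> /andP[x0 xy]; rewrite /cosh ler_pM2r ?invr_gt0// -subr_ge0.
have -> : expR y + expR (- y) - (expR x + expR (- x)) =
    (expR y - expR x) * (1 - expR (- x - y)).
  have xx := expRxMexpNx_1 x; have yy := expRxMexpNx_1 y.
  rewrite expRD; move: xx yy; move: (expR x) (expR y) (expR (- x)) (expR (- y)).
  move=> X Y X' Y' xx yy.
  have -> : (Y - X) * (1 - X' * Y') = Y - X - X' * (Y * Y') + (X * X') * Y' by ring.
  by rewrite xx yy; ring.
rewrite mulr_ge0// subr_ge0 ?ler_expR//.
by rewrite -[leRHS](@expR0 R) ler_expR; lra.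
Qed.

Lemma sinh_gt0 (x : R) : 0 < x -> 0 < sinh x.
Proof. by move=> x0; rewrite divr_gt0// subr_gt0 ltr_expR gtrN. Qed.

Lemma cosh0 : cosh 0 = 1 :> R.
Proof. by rewrite /cosh oppr0 expR0; lra. Qed.

Lemma cosh_ge1 (x : R) : 0 <= x -> 1 <= cosh x.
Proof. by move=> x0; rewrite -cosh0 ler_cosh// lexx. Qed.

Definition lorentz_gram (m : int) : R :=
  2 * pi * sigma ^+ 3 / (4 * sigma ^+ 2 + m%:~R ^+ 2).

Lemma lower_constant_gt0 : 0 < A.
Proof.
apply: divr_gt0; first by apply: mulr_gt0; rewrite exprn_gt0// pi_gt0.
by apply: sinh_gt0; rewrite mulr_gt0 ?pi_gt0// mulr_gt0.
Qed.

Lemma cosine_moments_lorentz : cosine_moments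
  (fun u => A * cosh (2 * sigma * u))
  (fun m => cos (m%:~R * pi) * lorentz_gram m).
Proof.
have a0 : 0 < 2 * sigma by rewrite mulr_gt0.
have [W [dW WE]] := cosine_momentsZ A (cosine_moments_cosh a0).
exists W; split => // m; rewrite WE /lorentz_gram /A.
have s0 : sinh (2 * sigma * pi) != 0.
  by rewrite gt_eqF// sinh_gt0// mulr_gt0// pi_gt0.
have p0 := lt0r_neq0 (pi_gt0 R); have sg0 := lt0r_neq0 sigma_gt0.
have m0 : 4 * sigma ^+ 2 + m%:~R ^+ 2 != 0 :> R.
  by rewrite gt_eqF// ltr_pwDl ?sqr_ge0// mulr_gt0// exprn_gt0.
move: s0; set S := sinh _; move: (cos _) => c; move: pi p0 => p p0 S0.
by field; rewrite S0 p0 m0.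
Qed.

Let twist (c : int -> R) k := cos (k%:~R * pi) * c k.

Lemma toeplitz_lorentz s c : toeplitz lorentz_gram s c =
  toeplitz (fun m => cos (m%:~R * pi) * lorentz_gram m) s (twist c).
Proof.
apply: eq_bigr => j _; apply: eq_bigr => k _.
have := cos_int_sqr j (sinpi R); have := cos_int_sqr k (sinpi R).
rewrite cos_intB ?sinpi// /twist.
set x := cos (k%:~R * pi); set y := cos (j%:~R * pi) => x1 y1.
have -> : y * c j * (x * c k) * (y * x * lorentz_gram (j - k)) =
  x ^+ 2 * (y ^+ 2 * (c j * c k * lorentz_gram (j - k))) by ring.
by rewrite x1 y1 !mul1r.
Qed.

Lemma twist_sqr c k : twist c k ^+ 2 = c k ^+ 2.
Proof. by rewrite exprMn cos_int_sqr ?sinpi// mul1r. Qed.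

Lemma cosh_arg_bounds u : 0 <= u <= pi ->
  1 <= cosh (2 * sigma * u) <= cosh (2 * sigma * pi).
Proof.
move=> /andP[u0 upi]; have a0 : 0 <= 2 * sigma by rewrite mulr_ge0// ltW.
by apply/andP; split; [apply: cosh_ge1|apply: ler_cosh]; rewrite mulr_ge0//= ler_wpM2l.
Qed.

Lemma lorentz_gram_bounds s c : uniq s ->
  A * (\sum_(k <- s) c k ^+ 2) <= toeplitz lorentz_gram s c
    <= A * cosh (2 * sigma * pi) * (\sum_(k <- s) c k ^+ 2).
Proof.
move=> us; rewrite toeplitz_lorentz.
rewrite -(eq_bigr _ (fun k _ => twist_sqr c k)).
apply: (toeplitz_bounds _ cosine_moments_lorentz) => // u /cosh_arg_bounds/andP[lo hi].
have A0 := ltW lower_constant_gt0.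
by apply/andP; split; [rewrite -[leLHS]mulr1|]; exact: ler_wpM2l.
Qed.

(** At v = 0 and v = pi the symbol takes its extreme values, so that
[lorentz_gram_bounds] is attained asymptotically. *)
Lemma lorentz_gram_sharp v e : sin v = 0 -> 0 <= v <= pi -> 0 < e ->
  exists C, forall N, exists c : int -> R,
    (forall k, c k ^+ 2 = 1) /\
    `|toeplitz lorentz_gram (initial_ints N) c
       - A * cosh (2 * sigma * v) * N%:R| <= e * N%:R + C.
Proof.
move=> sv vpi e0.
have bd u : 0 <= u <= pi ->
    `|A * cosh (2 * sigma * u) - A * cosh (2 * sigma * v)|
      <= A * cosh (2 * sigma * pi).
  move=> upi; rewrite -mulrBr normrM gtr0_norm ?lower_constant_gt0//.
  rewrite ler_pM2l ?lower_constant_gt0//.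
  have /andP[] := cosh_arg_bounds upi; have /andP[] := cosh_arg_bounds vpi.
  by move=> *; rewrite ler_norml; apply/andP; split; lra.
have cw : continuous (fun u => A * cosh (2 * sigma * u)).
  move=> u; apply: differentiable_continuous; apply/derivable1_diffP.
  have := is_deriveMl A (is_derive_argMl (is_derive_cosh (2 * sigma * u))).
  by move=> d; exact: ex_derive.
have [C CP] := toeplitz_asymptotics cosine_moments_lorentz sv vpi bd cw e0.
exists C => N; exists (twist (fun k => cos (k%:~R * v))); split=> [k|].
  by rewrite twist_sqr cos_int_sqr.
rewrite toeplitz_lorentz; have := CP N; congr (`|_ - _| <= _).
apply: eq_bigr => j _; apply: eq_bigr => k _; congr (_ * _ * _).
- by rewrite /twist mulrA -expr2 cos_int_sqr ?sinpi// mul1r.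
- by rewrite /twist mulrA -expr2 cos_int_sqr ?sinpi// mul1r.
Qed.
End LorentzGram.

(** * Inner products of shifted Lorentz functions *)

Section NewtonLeibnizLine.
Variable R : realType.
Local Notation mu := (@lebesgue_measure R).

(** The half-line formula on [0, +oo[, applied to f and to its reflection. *)
Let ge0_FTC2_line0 (f F : R -> R) (l l' : R) :
  (forall x, 0 <= f x) -> continuous f ->
  (forall x : R, is_derive x 1 F (f x)) ->
  F x @[x --> +oo] --> l -> F (- x) @[x --> +oo] --> l' ->
  (\int[mu]_x (f x)%:E = (l - l')%:E)%E.
Proof.
move=> f0 cf dF Fl Fl'.
have mf : measurable_fun [set: R] f by exact: continuous_measurable_fun.
have cF : continuous F.
  move=> x; apply: differentiable_continuous; apply/derivable1_diffP.
  exact: ex_derive.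
rewrite -(setUv [set x : R | 0 <= x]%R) ge0_integral_setU//= ; last 5 first.
- by rewrite -set_itvcy.
- by rewrite -set_itvcy; exact: measurableC.
- by apply/measurable_EFinP; rewrite setUv.
- by move=> x _; rewrite lee_fin.
- exact/disj_setPCl.
rewrite -set_itvcy// setCitvr.
rewrite integral_itv_bndo_bndc; last exact/measurable_EFinP/measurable_funTS.
rewrite -{2}oppr0 ge0_integration_by_substitutionNy//; last first.
  exact: continuous_subspaceT.
rewrite (@ge0_continuous_FTC2y R f F 0 l)//; first last.
- by move=> x _; rewrite derive1E; exact: derive_val.
- by apply: cvg_at_right_filter; exact: cF.
- exact: continuous_subspaceT.
have dFN (x : R) : is_derive x 1 (fun y => - F (- y)) (f (- x)).
  have d := is_derive1_comp (dF (- x)) (is_deriveNid x 1).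
  by apply: (is_derive_eq (is_deriveN d)); rewrite mulrN1 opprK.
rewrite (@ge0_continuous_FTC2y R (f \o -%R) (fun y => - F (- y)) 0 (- l'))//=.
- by rewrite oppr0 -!EFinD; congr EFin; ring.
- apply: continuous_subspaceT => x; apply: continuous_comp; last exact: cf.
  exact: continuousN.
- by apply: cvgN.
- apply: cvg_at_right_filter; apply: cvgN.
  by apply: (@continuous_comp _ _ _ -%R F); [exact: continuousN|exact: cF].
- by move=> x _; rewrite derive1E; exact: derive_val.
Qed.

Lemma ge0_FTC2_line (f F : R -> R) (l l' c : R) :
  (forall x, 0 <= f x) -> continuous f ->
  (forall x : R, is_derive x 1 F (f x)) ->
  F x @[x --> +oo] --> l -> F (- x) @[x --> +oo] --> l' ->
  (\int[mu]_x (f (x - c))%:E = (l - l')%:E)%E.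
Proof.
move=> f0 cf dF Fl Fl'.
apply: (@ge0_FTC2_line0 (fun x => f (x - c)) (fun x => F (x - c))) => //.
- move=> x; apply: (@continuous_comp _ _ _ (fun x => x - c) f); last exact: cf.
  by apply: cvgB; [exact: cvg_id|exact: cvg_cst].
- move=> x; have d : is_derive x 1 (fun y => y - c) (1 - 0).
    exact: (is_deriveB (is_derive_id x 1) (is_derive_cst c x 1)).
  apply: (is_derive_eq (@is_derive1_comp R F (fun y => y - c) x _ _ (dF _) d)).
  by rewrite subr0 mulr1.
- exact: (cvg_comp _ _ (@cvg_addrr R (- c)) Fl).
- have FE x : F (- x - c) = (fun y => F (- y)) (x + c) by rewrite opprD.
  under eq_cvg do rewrite FE.
  exact: (cvg_comp _ _ (@cvg_addrr R c) Fl').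
Qed.

Lemma cvgVy : x^-1 @[x --> +oo] --> (0 : R).
Proof.
apply/gtr0_cvgV0; last exact: cvg_id.
exact: nbhs_pinfty_gt.
Qed.

End NewtonLeibnizLine.

Section LorentzIntegral.
Variable R : realType.
Local Notation mu := (@lebesgue_measure R).
Variable sigma : R.
Hypothesis sigma_gt0 : 0 < sigma.

Let q (x : R) := sigma ^+ 2 + x ^+ 2.

Lemma quad_gt0 x : 0 < q x.
Proof. by rewrite ltr_pwDl ?sqr_ge0// exprn_gt0. Qed.

Lemma continuous_quad (c : R) : continuous (fun x => q (x - c)).
Proof.
move=> x; apply: cvgD; first exact: cvg_cst.
by rewrite !expr2; apply: cvgM; apply: cvgB; by [exact: cvg_id|exact: cvg_cst].
Qed.

Lemma is_derive_atan_scaled (m x : R) :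
  is_derive x 1 (fun y => atan ((y - m) / sigma)) (sigma / q (x - m)).
Proof.
have d1 : is_derive x 1 (fun y : R => (y - m) / sigma) sigma^-1.
  apply: (is_derive_eq (is_deriveM (is_deriveB (is_derive_id x 1)
    (is_derive_cst m x 1)) (is_derive_cst sigma^-1 x 1))).
  by rewrite /GRing.scale/= /cst subr0 !fctE; ring.
have d2 := @is_derive1_comp R (@atan R) (fun y => (y - m) / sigma) x _ _
  (is_derive1_atan _) d1.
apply: (is_derive_eq d2).
have := lt0r_neq0 (quad_gt0 (x - m)); rewrite /q => qm.
have s0 := lt0r_neq0 sigma_gt0.
by field; rewrite qm s0.
Qed.

Lemma is_derive_ln_quad (m x : R) :
  is_derive x 1 (fun y => ln (q (y - m))) (2 * (x - m) / q (x - m)).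
Proof.
have d1 : is_derive x 1 (fun y : R => q (y - m)) (2 * (x - m)).
  apply: (is_derive_eq (is_deriveD (is_derive_cst (sigma ^+ 2) x 1)
    (is_deriveX 2 (is_deriveB (is_derive_id x 1) (is_derive_cst m x 1))))).
  by rewrite /GRing.scale/= /cst subr0 !fctE; ring.
have d2 := @is_derive1_comp R (@ln R) (fun y => q (y - m)) x _ _
  (is_derive1_ln (quad_gt0 (x - m))) d1.
apply: (is_derive_eq d2).
by rewrite mulrC.
Qed.

Lemma cvgy_atan_scaled (m : R) :
  atan ((x - m) / sigma) @[x --> +oo] --> (pi / 2 : R).
Proof.
apply: (@cvg_comp _ _ _ (fun x => (x - m) / sigma) (@atan R)
  (pinfty_nbhs R) (pinfty_nbhs R)); last exact: cvgy_atan.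
under eq_cvg do rewrite mulrC.
apply: gt0_cvgMry; first by rewrite invr_gt0.
exact: cvg_addrr.
Qed.

(** The quotient of the two quadratics is a rational function of 1/x that is
continuous at 0 with value 1. *)
Lemma cvgy_ln_quad (m : R) :
  ln (q x) - ln (q (x - m)) @[x --> +oo] --> (0 : R).
Proof.
pose r (t : R) := (sigma ^+ 2 * t ^+ 2 + 1) / (sigma ^+ 2 * t ^+ 2 + (1 - m * t) ^+ 2).
have r1 : r x^-1 @[x --> +oo] --> (1 : R).
  have t0 := @cvgVy R.
  have -> : 1 = (sigma ^+ 2 * 0 ^+ 2 + 1) / (sigma ^+ 2 * 0 ^+ 2 + (1 - m * 0) ^+ 2) :> R.
    by rewrite expr0n /= !mulr0 add0r add0r subr0 expr1n divr1.
  have ct : sigma ^+ 2 * x^-1 ^+ 2 @[x --> +oo] --> (sigma ^+ 2 * 0 ^+ 2 : R).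
    by apply: cvgMr; rewrite !expr2; exact: cvgM.
  apply: cvgM; first by apply: cvgD => //; exact: cvg_cst.
  apply: cvgV; first by rewrite expr0n /= !mulr0 add0r subr0 expr1n oner_neq0.
  apply: cvgD => //; rewrite !expr2.
  have c1 : 1 - m * x^-1 @[x --> +oo] --> (1 - m * 0 : R).
    by apply: cvgB; [exact: cvg_cst|exact: cvgMr].
  exact: cvgM.
have lnr : ln (r x^-1) @[x --> +oo] --> (0 : R).
  rewrite -[X in _ --> X](@ln1 R).
  by apply: (cvg_comp _ _ r1); exact: continuous_ln.
apply: cvg_trans lnr; apply: near_eq_cvg; near=> x.
have x0 : 0 < x by near: x; exact: nbhs_pinfty_gt.
have q0 y := quad_gt0 y.
rewrite /= -ln_div ?posrE//; congr ln.
have xN0 := lt0r_neq0 x0; have qxm := lt0r_neq0 (quad_gt0 (x - m)).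
have -> : r x^-1 = (q x / x ^+ 2) / (q (x - m) / x ^+ 2).
  by rewrite /r /q; congr (_ / _); field.
by rewrite invf_div mulrA divfK// expf_neq0.
Unshelve. all: by end_near. Qed.

(** Partial fractions give an antiderivative with a logarithm of
q x / q (x - m), which vanishes at both ends, and two arctangents.  For m = 0 the logarithm
degenerates into a rational term. *)
Lemma integral_lorentz_product (c m : R) :
  (\int[mu]_x ((q (x - c) * q (x - c - m))^-1)%:E =
   (2 * pi / (sigma * (4 * sigma ^+ 2 + m ^+ 2)))%:E)%E.
Proof.
have q0 x := lt0r_neq0 (quad_gt0 x); have s0 := lt0r_neq0 sigma_gt0.
have f0 x : 0 <= (q x * q (x - m))^-1.
  by rewrite invr_ge0 mulr_ge0// ltW// quad_gt0.
have cf : continuous (fun x => (q x * q (x - m))^-1).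
  move=> x; apply: cvgV; first by rewrite mulf_neq0.
  apply: cvgM; last exact: continuous_quad.
  have := @continuous_quad 0 x; rewrite (_ : (fun y => q (y - 0)) = q) ?subr0//.
  by apply/funext => y; rewrite subr0.
have D0 : 4 * sigma ^+ 2 + m ^+ 2 != 0.
  by rewrite lt0r_neq0// ltr_pwDl ?sqr_ge0// mulr_gt0// exprn_gt0.
have at0 := is_derive_atan_scaled 0.
have atm := is_derive_atan_scaled m.
have ln0 := is_derive_ln_quad 0.
have lnm := is_derive_ln_quad m.
have [m0|m0] := eqVneq m 0.
  (* antiderivative of 1 / q^2 *)
  subst m; pose F (x : R) := (2 * sigma ^+ 2)^-1 *
    (x * (q x)^-1 + sigma^-1 * atan ((x - 0) / sigma)).
  have xq0 : x * (q x)^-1 @[x --> +oo] --> (0 : R).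
    apply: (@squeeze_cvgr _ _ _ _ (cst 0) (fun x : R => x^-1)); last 2 first.
    - exact: cvg_cst.
    - exact: cvgVy.
    near=> x; have x0 : 0 < x by near: x; exact: nbhs_pinfty_gt.
    rewrite mulr_ge0 ?invr_ge0 ?(ltW x0) ?(ltW (quad_gt0 x))//=.
    by rewrite ler_pdivrMr ?quad_gt0// mulrC ler_pdivlMr// -expr2 /q lerDr sqr_ge0.
  have -> : (2 * pi / (sigma * (4 * sigma ^+ 2 + 0 ^+ 2)))%:E =
      ((2 * sigma ^+ 2)^-1 * (0 + sigma^-1 * (pi / 2)) -
       (2 * sigma ^+ 2)^-1 * (- 0 + sigma^-1 * (- (pi / 2))))%:E.
    congr EFin; move: pi => p; by field; rewrite s0.
  apply: (@ge0_FTC2_line R (fun x => (q x * q (x - 0))^-1) F) => //.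
  - move=> x; have dq : is_derive x 1 q (2 * x).
      apply: (is_derive_eq (is_deriveD (is_derive_cst (sigma ^+ 2) x 1)
        (is_deriveX 2 (is_derive_id x 1)))).
      by rewrite /GRing.scale/=; ring.
    have dqV : is_derive x 1 (fun y => (q y)^-1) (- (q x) ^- 2 * (2 * x)).
      have dqx : derivable q x 1 by exact: ex_derive.
      apply: DeriveDef; first exact: derivableV.
      by rewrite deriveV// derive_val.
    apply: (is_derive_eq (is_deriveMl (2 * sigma ^+ 2)^-1 (is_deriveD
      (is_deriveM (is_derive_id x 1) dqV) (is_deriveMl sigma^-1 (at0 x))))).
    rewrite subr0 /GRing.scale/=; move: (q0 x); rewrite /q => qx.
    by field; rewrite qx s0.
  - apply: cvgMr; apply: cvgD => //; apply: cvgMr; exact: cvgy_atan_scaled.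
  - have FN x : F (- x) = (2 * sigma ^+ 2)^-1 *
        (- (x * (q x)^-1) + sigma^-1 * - atan ((x - 0) / sigma)).
      by rewrite /F -atanN /q sqrrN !mulNr !subr0 mulNr.
    under eq_cvg do rewrite FN.
    apply: cvgMr; apply: cvgD; first exact: cvgN.
    by apply: cvgMr; apply: cvgN; exact: cvgy_atan_scaled.
pose D := 4 * sigma ^+ 2 + m ^+ 2.
(* partial fractions: D / (q x q (x - m)) equals
   (2 x / m + 1) / q x + (1 - 2 (x - m) / m) / q (x - m) *)
pose F x := D^-1 * (m^-1 * (ln (q (x - 0)) - ln (q (x - m))) +
   sigma^-1 * (atan ((x - 0) / sigma) + atan ((x - m) / sigma))).
have -> : (2 * pi / (sigma * (4 * sigma ^+ 2 + m ^+ 2)))%:E =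
    (D^-1 * (m^-1 * 0 + sigma^-1 * (pi / 2 + pi / 2)) -
     D^-1 * (m^-1 * 0 + sigma^-1 * (- (pi / 2) + - (pi / 2))))%:E.
  congr EFin; move: pi => p; rewrite /D; by field; rewrite s0 D0 m0.
apply: (@ge0_FTC2_line R (fun x => (q x * q (x - m))^-1) F) => //.
- move=> x; apply: (is_derive_eq (is_deriveMl D^-1 (is_deriveD
    (is_deriveMl m^-1 (is_deriveB (ln0 x) (lnm x)))
    (is_deriveMl sigma^-1 (is_deriveD (at0 x) (atm x)))))).
  move: (q0 x) (q0 (x - m)); rewrite /q /D => qx qxm.
  by field; rewrite qxm qx s0 m0 D0.
- have FP x : F x = D^-1 * (m^-1 * (ln (q x) - ln (q (x - m))) +
      sigma^-1 * (atan ((x - 0) / sigma) + atan ((x - m) / sigma))).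
    by rewrite /F [in q (x - 0)]subr0.
  under eq_cvg do rewrite FP.
  apply: cvgMr; apply: cvgD; apply: cvgMr; first exact: cvgy_ln_quad.
  by apply: cvgD; exact: cvgy_atan_scaled.
- have FN x : F (- x) = D^-1 * (m^-1 * (ln (q x) - ln (q (x - - m))) +
      sigma^-1 * (- atan ((x - 0) / sigma) + - atan ((x - - m) / sigma))).
    rewrite /F -!atanN -!mulNr.
    congr (_ * (_ * (ln _ - ln _) + _ * (atan (_ / _) + atan (_ / _))));
    by rewrite /q; ring.
  under eq_cvg do rewrite FN.
  apply: cvgMr; apply: cvgD; apply: cvgMr; first exact: cvgy_ln_quad.
  by apply: cvgD; apply: cvgN; exact: cvgy_atan_scaled.
Unshelve. all: by end_near. Qed.

Lemma integral_lorentzM (j k : int) :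
  (\int[mu]_x (lorentz (x - j%:~R) sigma * lorentz (x - k%:~R) sigma)%:E =
   (lorentz_gram sigma (j - k))%:E)%E.
Proof.
have q0 x := lt0r_neq0 (quad_gt0 x); have s0 := lt0r_neq0 sigma_gt0.
pose m : R := (k - j)%:~R.
have -> : (fun x : R => (lorentz (x - j%:~R) sigma *
      lorentz (x - k%:~R) sigma)%:E) =
    (fun x => (sigma ^+ 4)%:E * ((q (x - j%:~R) * q (x - j%:~R - m))^-1)%:E)%E.
  apply/funext => x; rewrite -EFinM /lorentz -!/(q _); congr EFin.
  have -> : x - j%:~R - m = x - k%:~R by rewrite /m intrB; ring.
  by move: (q0 (x - j%:~R)) (q0 (x - k%:~R)) => qj qk; field; rewrite qj qk.
rewrite ge0_integralZl//; last 3 first.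
- apply/measurable_EFinP; apply: continuous_measurable_fun => x.
  apply: cvgV; first by rewrite mulf_neq0.
  apply: cvgM; first exact: continuous_quad.
  have -> : (fun y : R => q (y - j%:~R - m)) = (fun y => q (y - (j%:~R + m))).
    by apply/funext => y; rewrite opprD addrA.
  by rewrite -addrA -opprD; exact: continuous_quad.
- by move=> x _; rewrite lee_fin invr_ge0 mulr_ge0// ltW// quad_gt0.
- by rewrite lee_fin exprn_ge0// ltW.
rewrite integral_lorentz_product -EFinM; congr EFin.
rewrite /lorentz_gram.
have -> : (j - k)%:~R ^+ 2 = m ^+ 2 by rewrite -sqrrN /m -rmorphN opprB.
have D0 : 4 * sigma ^+ 2 + m ^+ 2 != 0.
  by rewrite lt0r_neq0// ltr_pwDl ?sqr_ge0// mulr_gt0// exprn_gt0.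
by move: D0; move: m (pi : R) => m' p D0; field; rewrite s0 D0.
Qed.
End LorentzIntegral.

(** * Finite combinations of shifts and the L2 norm *)

Section FiniteCombinations.
Variable R : realType.
Local Notation mu := (@lebesgue_measure R).
Variable sigma : R.
Hypothesis sigma_gt0 : 0 < sigma.

Definition lorentz_comb (s : seq int) (a : int -> R) (x : R) : R :=
  \sum_(k <- s) a k * lorentz (x - k%:~R) sigma.

Lemma continuous_lorentz (c : R) : continuous (fun x => lorentz (x - c) sigma).
Proof.
move=> x; apply: cvgM; first exact: cvg_cst.
apply: cvgV; first exact: lt0r_neq0 (quad_gt0 sigma_gt0 _).
exact: continuous_quad.
Qed.

Lemma measurable_lorentz (c : R) :
  measurable_fun [set: R] (fun x => lorentz (x - c) sigma).
Proof. by apply: continuous_measurable_fun; exact: continuous_lorentz. Qed.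

Lemma lorentz_ge0 (x : R) : 0 <= lorentz x sigma.
Proof. by rewrite divr_ge0 ?sqr_ge0 ?addr_ge0 ?sqr_ge0. Qed.

Lemma measurable_lorentz_comb s a : measurable_fun [set: R] (lorentz_comb s a).
Proof.
rewrite /lorentz_comb; apply: measurable_sum => k.
by apply: measurable_funM; [exact: measurable_cst|exact: measurable_lorentz].
Qed.

(** The factor [r] lets the same statement cover both a plain product of shifts
and the terms of an expanded square. *)
Lemma integrable_lorentzM (r : R) (j k : int) : mu.-integrable [set: R]
  (fun x => (r * (lorentz (x - j%:~R) sigma * lorentz (x - k%:~R) sigma))%:E).
Proof.
rewrite [X in integrable _ _ X](_ : _ = (fun x => r%:E *
  (lorentz (x - j%:~R) sigma * lorentz (x - k%:~R) sigma)%:E)%E); last first.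
  by apply/funext => x; rewrite /= EFinM.
apply: integrableZl => //.
apply/integrableP; split.
  by apply/measurable_EFinP; apply: measurable_funM; exact: measurable_lorentz.
have prod_ge0 (x : R) : 0 <= lorentz (x - j%:~R) sigma * lorentz (x - k%:~R) sigma.
  by rewrite mulr_ge0// lorentz_ge0.
under eq_integral do rewrite gee0_abs ?lee_fin ?prod_ge0//.
by rewrite integral_lorentzM// ltry.
Qed.

Lemma integral_lorentz_comb_sqr s a :
  (\int[mu]_x ((lorentz_comb s a x) ^+ 2)%:E =
   (toeplitz (lorentz_gram sigma) s a)%:E)%E.
Proof.
have E x : ((lorentz_comb s a x) ^+ 2)%:E =
  (\sum_(j <- s) \sum_(k <- s) (a j * a k *
    (lorentz (x - j%:~R) sigma * lorentz (x - k%:~R) sigma))%:E)%E.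
  rewrite expr2 /lorentz_comb mulr_suml -sumEFin; apply: eq_bigr => j _.
  by rewrite mulr_sumr -sumEFin; apply: eq_bigr => k _; congr EFin; ring.
under eq_integral do rewrite E.
rewrite integral_sum//; last first.
  by move=> j; apply: integrable_sum => // k _; exact: integrable_lorentzM.
rewrite /toeplitz -sumEFin; apply: eq_bigr => j _.
rewrite integral_sum//; last by move=> k; exact: integrable_lorentzM.
rewrite -sumEFin; apply: eq_bigr => k _.
under eq_integral do rewrite EFinM.
rewrite integralZl//; last first.
  have := integrable_lorentzM 1 j k; congr (integrable _ _ _).
  by apply/funext => x; rewrite mul1r.
by rewrite integral_lorentzM// -EFinM.
Qed.
End FiniteCombinations.

Section L2Norm.
Variable R : realType.
Local Notation mu := (@lebesgue_measure R).
Implicit Type f : R -> R[i].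

(** The squared L2 norm, as an integral that splits into real and imaginary
parts. *)
Definition energy f : \bar R :=
  (\int[mu]_x (complex.Re (f x) ^+ 2 + complex.Im (f x) ^+ 2)%:E)%E.

Lemma L2norm_ge0 f : (0 <= L2norm f)%E.
Proof. exact: Lnorm_ge0. Qed.

Lemma normc_sqr (z : R[i]) :
  ComplexField.Normc.normc z ^+ 2 = complex.Re z ^+ 2 + complex.Im z ^+ 2.
Proof. by case: z => a b /=; rewrite sqr_sqrtr// addr_ge0 ?sqr_ge0. Qed.

Lemma normc_ge0 (z : R[i]) : 0 <= ComplexField.Normc.normc z.
Proof. by case: z => a b; exact: sqrtr_ge0. Qed.

Lemma poweR2 (y : \bar R) : (0 <= y)%E -> (y `^ 2 = y ^+ 2)%E.
Proof.
case: y => [r r0| _|//]; last by rewrite poweRyr// expe2 mulyy.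
by rewrite poweR_EFin powR_mulrn// -EFin_expe.
Qed.

Lemma L2norm_sqr f : (L2norm f ^+ 2)%E = energy f.
Proof.
rewrite -poweR2 ?L2norm_ge0// /L2norm poweR_Lnorm ?pnatr_eq0//.
apply: eq_integral => x _; rewrite poweR2 ?abse_ge0// gee0_abs ?lee_fin ?normc_ge0//.
by rewrite -EFin_expe normc_sqr.
Qed.
End L2Norm.

(** * Finite windows of an ell2 sequence *)

Section Windows.
Variable R : realType.
Implicit Types (c : int -> R[i]) (s : seq int).

(** The indices met by a two-sided partial sum; note that Negz k = - (k + 1). *)
Definition window m n : seq int :=
  [seq Negz k | k <- index_iota 0 m] ++ [seq Posz k | k <- index_iota 0 n].

Lemma uniq_window m n : uniq (window m n).
Proof.
rewrite cat_uniq !map_inj_uniq ?iota_uniq; try by move=> i j [].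
rewrite andbT /=; apply/hasPn => _ /(@seq.mapP nat int)[k _ ->].
by apply/(@seq.mapP nat int) => -[].
Qed.

Lemma mem_window (k : int) m n :
  (k \in window m n) = match k with Posz i => (i < n)%N | Negz i => (i < m)%N end.
Proof.
have memP (b : nat -> int) i l : injective b ->
    (b i \in [seq b j | j <- index_iota 0 l]) = (i < l)%N.
  by move=> bI; rewrite mem_map// mem_index_iota.
rewrite mem_cat; case: k => i.
  rewrite (memP Posz) => [|? ? []//]; case: (i < n)%N; rewrite ?orbT// orbF.
  by apply/negP => /(@seq.mapP nat int)[].
rewrite (memP Negz) => [|? ? []//]; case: (i < m)%N => //=.
by apply/negP => /(@seq.mapP nat int)[].
Qed.

Lemma window_sub m n m' n' : (m <= m')%N -> (n <= n')%N ->
  {subset window m n <= window m' n'}.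
Proof.
by move=> mm nn [i|i]; rewrite !mem_window => /leq_trans; apply.
Qed.

Lemma abs_mem_window (k : int) N : (`|k| < N)%N -> k \in window N N.
Proof. by case: k => k kN; rewrite mem_window//= ltnW. Qed.

Lemma partial_sum_window phi c m n x :
  partial_sum phi c m n x = \sum_(k <- window m n) c k * phi k x.
Proof. by rewrite /partial_sum big_cat !big_map !big_mkord. Qed.

Lemma sum_mem_uniq (V : zmodType) (F : int -> V) s t : uniq s -> uniq t ->
  {subset t <= s} ->
  \sum_(k <- s) (if k \in t then F k else 0) = \sum_(k <- t) F k.
Proof.
move=> us ut ts; rewrite -big_mkcond -big_filter; apply: perm_big.
apply: uniq_perm => //; first exact: filter_uniq.
by move=> k; rewrite mem_filter; case: (boolP (k \in t)) => // /ts ->.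
Qed.

(** The difference of two nested partial sums is again a partial sum, with the
inner coefficients set to 0. *)
Lemma sum_notin_uniq (V : zmodType) (F : int -> V) s t : uniq s -> uniq t ->
  {subset t <= s} ->
  \sum_(k <- s) (if k \in t then 0 else F k) =
  \sum_(k <- s) F k - \sum_(k <- t) F k.
Proof.
move=> us ut ts; rewrite -(sum_mem_uniq F us ut ts) -sumrB.
by apply: eq_bigr => k _; case: (k \in t); rewrite ?subrr ?subr0.
Qed.

Definition mass s c : R := \sum_(k <- s) ComplexField.Normc.normc (c k) ^+ 2.

Lemma mass_le_sqnorm s c : uniq s -> ((mass s c)%:E <= sqnorm_ell2 c)%E.
Proof.
move=> us; apply: ereal_sup_ubound; exists [set` s].
  by split => //; exact: finite_seq.
by rewrite -fsbig_seq//= sumEFin.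
Qed.

Lemma sqnorm_ge0 c : (0 <= sqnorm_ell2 c)%E.
Proof. by apply: esum_ge0 => k _; rewrite lee_fin sqr_ge0. Qed.

Lemma sqnorm_fin c : ell2 c -> sqnorm_ell2 c \is a fin_num.
Proof. by move=> c2; rewrite ge0_fin_numE ?sqnorm_ge0. Qed.

(** A finite set that nearly exhausts the sum lies in some window, and enlarging
the window only adds nonnegative terms. *)
Lemma mass_window_near c e : ell2 c -> 0 < e -> exists M, forall m n,
  (M <= m)%N -> (M <= n)%N -> fine (sqnorm_ell2 c) - e <= mass (window m n) c.
Proof.
move=> c2 e0; have cfin := sqnorm_fin c2.
have [_ [F [finF _] <-] Fe] := ub_ereal_sup_adherent e0 cfin.
have /finite_seqP[t Ft] := finF.
exists (\max_(k <- t) `|k|%N).+1 => m n Mm Mn.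
rewrite -lee_fin EFinB fineK//; apply: (le_trans (ltW Fe)).
rewrite {F finF Fe}Ft; set u := undup t.
have -> : [set` t] = [set` u] by apply/seteqP; split => k /=; rewrite mem_undup.
rewrite -fsbig_seq ?undup_uniq//= sumEFin lee_fin.
have sub : {subset u <= window m n}.
  move=> k; rewrite mem_undup => kt.
  apply: (window_sub Mm Mn); apply: abs_mem_window; rewrite ltnS.
  exact: (@leq_bigmax_seq int t xpredT absz k kt).
rewrite -subr_ge0 -(sum_notin_uniq _ (uniq_window m n) (undup_uniq t) sub).
by apply: sumr_ge0 => k _; case: ifP => // _; exact: sqr_ge0.
Qed.

Lemma sqnorm_finite_support s c : uniq s ->
  sqnorm_ell2 (fun k => if k \in s then c k else 0) = (mass s c)%:E.
Proof.
move=> us; rewrite /sqnorm_ell2.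
rewrite (_ : (fun k => _) = (fun k => if k \in [set` s] then
    (ComplexField.Normc.normc (c k) ^+ 2)%:E else 0%E)); last first.
  apply/funext => k; rewrite mem_setE; case: ifP => // _.
  by rewrite ComplexField.Normc.normc0 expr0n.
rewrite -esum_mkcond esum_fset.
- by rewrite -fsbig_seq//= sumEFin.
- exact: finite_seq.
- by move=> k _; rewrite lee_fin sqr_ge0.
Qed.
End Windows.

Section ComplexCombinations.
Variable R : realType.
Variable sigma : R.
Hypothesis sigma_gt0 : 0 < sigma.
Implicit Types (c : int -> R[i]) (s : seq int).

Definition shift_comb s c (x : R) : R[i] :=
  \sum_(k <- s) c k * lorentz_shifts sigma k x.

Lemma shift_combE s c x : shift_comb s c x =
  Complex (lorentz_comb sigma s (fun k => complex.Re (c k)) x)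
          (lorentz_comb sigma s (fun k => complex.Im (c k)) x).
Proof.
rewrite /shift_comb /lorentz_comb; elim: s => [|k s IHs]; first by rewrite !big_nil.
rewrite !big_cons IHs /lorentz_shifts; case: (c k) => a b.
by simpc.
Qed.

Let A : R := sigma ^+ 2 * pi ^+ 2 / sinh (2 * sigma * pi).
Let B : R := A * cosh (2 * sigma * pi).

Lemma energy_shift_comb s c : energy (shift_comb s c) =
  (toeplitz (lorentz_gram sigma) s (fun k => complex.Re (c k)) +
   toeplitz (lorentz_gram sigma) s (fun k => complex.Im (c k)))%:E.
Proof.
rewrite /energy; under eq_integral do rewrite shift_combE /= EFinD.
rewrite ge0_integralD//.
- by rewrite !integral_lorentz_comb_sqr// EFinD.
- by move=> x _; rewrite lee_fin sqr_ge0.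
- apply/measurable_EFinP; apply: measurable_funX; exact: measurable_lorentz_comb.
- by move=> x _; rewrite lee_fin sqr_ge0.
- apply/measurable_EFinP; apply: measurable_funX; exact: measurable_lorentz_comb.
Qed.

Lemma energy_shift_comb_bounds s c : uniq s ->
  ((A * mass s c)%:E <= energy (shift_comb s c) <= (B * mass s c)%:E)%E.
Proof.
move=> us; rewrite energy_shift_comb !lee_fin.
have -> : mass s c = \sum_(k <- s) complex.Re (c k) ^+ 2 +
    \sum_(k <- s) complex.Im (c k) ^+ 2.
  by rewrite -big_split; apply: eq_bigr => k _; exact: normc_sqr.
have /andP[lo1 up1] := lorentz_gram_bounds sigma_gt0 (fun k => complex.Re (c k)) us.
have /andP[lo2 up2] := lorentz_gram_bounds sigma_gt0 (fun k => complex.Im (c k)) us.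
by rewrite !mulrDr !lerD.
Qed.
End ComplexCombinations.

(** * Pointwise summation and Fatou's lemma *)

Section PointwiseLimit.
Variable R : realType.
Local Notation mu := (@lebesgue_measure R).
Variable sigma : R.
Hypothesis sigma_gt0 : 0 < sigma.

(** With y = x - k, this follows from k^2 <= 2 x^2 + 2 y^2. *)
Lemma lorentz_decay (x : R) (k : int) :
  lorentz (x - k%:~R) sigma * (1 + k%:~R ^+ 2) <=
  1 + 2 * x ^+ 2 + 2 * sigma ^+ 2.
Proof.
set y := x - k%:~R; have -> : k%:~R = x - y :> R by rewrite /y; ring.
rewrite /lorentz mulrAC ler_pdivrMr ?quad_gt0//.
have s2 := sqr_ge0 sigma; have x2 := sqr_ge0 x; have y2 := sqr_ge0 y.
have xy := sqr_ge0 (x + y).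
have sxy : 0 <= sigma ^+ 2 * (x + y) ^+ 2 by rewrite mulr_ge0.
have ss : 0 <= sigma ^+ 2 * sigma ^+ 2 by rewrite mulr_ge0.
have x2y2 : 0 <= x ^+ 2 * y ^+ 2 by rewrite mulr_ge0.
nra.
Qed.

(** Bounded coefficients suffice: the terms are O(1/k^2), dominated by the
telescoping series of 1 / ((k + 1)(k + 2)). *)
Lemma is_cvg_lorentz_comb (a : int -> R) (M x : R) : (forall k, `|a k| <= M) ->
  cvgn (fun n => lorentz_comb sigma (window n n) a x).
Proof.
move=> aM; pose phi (k : int) := lorentz (x - k%:~R) sigma.
pose u i := a (Negz i) * phi (Negz i) + a (Posz i) * phi (Posz i).
have -> : (fun n => lorentz_comb sigma (window n n) a x) = series u.
  apply/funext => n; rewrite /lorentz_comb /window big_cat !big_map /series /=.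
  by rewrite -big_split.
pose C := 1 + 2 * x ^+ 2 + 2 * sigma ^+ 2.
have C0 : 0 <= C by rewrite !addr_ge0// mulr_ge0// sqr_ge0.
have M0 : 0 <= M := le_trans (normr_ge0 _) (aM 0).
have aphi (k : int) : `|a k * phi k| * (1 + k%:~R ^+ 2) <= M * C.
  rewrite normrM (ger0_norm (lorentz_ge0 _ _)) -mulrA ler_pM//.
    by rewrite mulr_ge0 ?lorentz_ge0// addr_ge0// sqr_ge0.
  exact: lorentz_decay.
(* 8 comes from (i + 1)(i + 2) <= 4 (1 + i^2) and from the two indices
   Posz i and Negz i of the i-th term *)
pose w (i : nat) : R := - (8 * (M * C)) * i.+1%:R^-1.
have cw : cvgn (series (telescope w)).
  rewrite telescopeK; apply: is_cvgB; last exact: is_cvg_cst.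
  apply: is_cvgMr; exact: (cvgP _ cvg_harmonic).
have vE i : telescope w i = 8 * (M * C) / (i.+1%:R * i.+2%:R).
  rewrite /telescope /w /= -(natr1 i.+1).
  have i1 : i.+1%:R != 0 :> R by rewrite pnatr_eq0.
  have i2 : i.+1%:R + 1 != 0 :> R by rewrite natr1 pnatr_eq0.
  by move: (M * C) i.+1%:R i1 i2 => K t t0 t1; field; rewrite t0 t1.
apply: normed_cvg; apply: series_le_cvg cw => i.
- exact: normr_ge0.
- by rewrite vE divr_ge0 ?mulr_ge0// ltW// mulr_gt0.
rewrite vE ler_pdivlMr ?mulr_gt0//.
have i2 : i.+1%:R * i.+2%:R <= 4 * (1 + i%:R ^+ 2) :> R.
  by rewrite -!natr1; have := sqr_ge0 (i%:R - 1 : R); nra.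
have a1 := aphi (Posz i); have a2 := aphi (Negz i).
have N2 : i%:R ^+ 2 <= (Negz i)%:~R ^+ 2 :> R.
  have -> : (Negz i)%:~R = - (i%:R + 1) :> R by rewrite NegzE rmorphN /= natr1.
  by have := ler0n R i; nra.
have u1 : `|a (Posz i) * phi (Posz i)| * (1 + i%:R ^+ 2) <= M * C by [].
have u2 : `|a (Negz i) * phi (Negz i)| * (1 + i%:R ^+ 2) <= M * C.
  by apply: le_trans a2; rewrite ler_wpM2l ?normr_ge0// lerD2l.
have := ler_normD (a (Negz i) * phi (Negz i)) (a (Posz i) * phi (Posz i)).
rewrite -/(u i) => ule.
apply: (@le_trans _ _ (`|u i| * (4 * (1 + i%:R ^+ 2)))).
  by apply: ler_wpM2l i2; exact: normr_ge0.
have q0 : 0 <= 4 * (1 + i%:R ^+ 2) :> R by rewrite mulr_ge0// addr_ge0// sqr_ge0.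
apply: (le_trans (ler_wpM2r q0 ule)).
by lra.
Qed.
End PointwiseLimit.

Section Fatou.
Variable R : realType.
Local Notation mu := (@lebesgue_measure R).

Lemma measurable_sqr_sum (p q : R -> R) :
  measurable_fun [set: R] p -> measurable_fun [set: R] q ->
  measurable_fun [set: R] (fun x => (p x ^+ 2 + q x ^+ 2)%:E).
Proof.
by move=> mp mq; apply/measurable_EFinP; apply: measurable_funD;
  exact: measurable_funX.
Qed.

(** The bound is asked for large n only: a difference of partial sums is a sum
over the remaining indices once one window contains the other. *)
Lemma energy_fatou (g : nat -> R -> R[i]) (h : R -> R[i]) (K : \bar R) N :
  (forall n, measurable_fun [set: R] (fun x => complex.Re (g n x))) ->
  (forall n, measurable_fun [set: R] (fun x => complex.Im (g n x))) ->
  (forall x, complex.Re (g n x) @[n --> \oo] --> complex.Re (h x)) ->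
  (forall x, complex.Im (g n x) @[n --> \oo] --> complex.Im (h x)) ->
  (forall n, (N <= n)%N -> (energy (g n) <= K)%E) -> (energy h <= K)%E.
Proof.
move=> mRe mIm cRe cIm gK.
pose sq n x : \bar R := (complex.Re (g n x) ^+ 2 + complex.Im (g n x) ^+ 2)%:E.
have csq x : (sq n x @[n --> \oo] -->
    (complex.Re (h x) ^+ 2 + complex.Im (h x) ^+ 2)%:E)%E.
  apply: cvg_EFin; first exact: nearW.
  by apply: cvgD; rewrite !expr2; exact: cvgM.
have -> : energy h = (\int[mu]_x limn_einf (sq ^~ x))%E.
  by apply: eq_integral => x _; have [-> _] := cvg_limn_einf_sup (csq x).
apply: (le_trans (fatou _ measurableT _ _)) => [n|n x _|].
- exact: measurable_sqr_sum.
- by rewrite lee_fin addr_ge0 ?sqr_ge0.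
rewrite limn_einf_lim; apply: lime_le; first exact: is_cvg_einfs.
exists N => // n /= Nn; apply: (le_trans _ (gK n Nn)).
by apply: ereal_inf_lbound; exists n => /=.
Qed.
End Fatou.

(** * Comparison of L2 norms *)

Section Energy.
Variable R : realType.
Local Notation mu := (@lebesgue_measure R).
Implicit Types f g : R -> R[i].

Definition measurable_complex f :=
  measurable_fun [set: R] (fun x => complex.Re (f x)) /\
  measurable_fun [set: R] (fun x => complex.Im (f x)).

Lemma energy_ge0 f : (0 <= energy f)%E.
Proof. by apply: integral_ge0 => x _; rewrite lee_fin addr_ge0 ?sqr_ge0. Qed.

Lemma Lfun2_of_sqr (p : R -> R) : measurable_fun [set: R] p ->
  (\int[mu]_x (p x ^+ 2)%:E < +oo)%E -> p \in Lfun mu 2%:E.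
Proof.
move=> mp pfin; rewrite inE; apply/andP; split; rewrite inE//=.
have two0 : 2 != 0 :> R by rewrite pnatr_eq0.
rewrite /finite_norm; apply: (lty_poweRy two0); rewrite poweR_Lnorm//.
apply: le_lt_trans pfin; rewrite le_eqVlt; apply/orP; left; apply/eqP.
apply: eq_integral => x _.
by rewrite poweR2 ?abse_ge0// -[`|_|%E]/(`|p x|%:E) -EFin_expe real_normK ?num_real.
Qed.

Lemma L2_of_energy f : measurable_complex f -> (energy f < +oo)%E -> L2 f.
Proof.
move=> [mRe mIm] fin; split; apply: Lfun2_of_sqr => //;
  apply: le_lt_trans fin; apply: ge0_le_integral => //.
- by move=> x _; rewrite lee_fin sqr_ge0.
- by apply/measurable_EFinP; exact: measurable_funX.
- exact: measurable_sqr_sum.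
- by move=> x _; rewrite lee_fin lerDl sqr_ge0.
- by move=> x _; rewrite lee_fin sqr_ge0.
- by apply/measurable_EFinP; exact: measurable_funX.
- exact: measurable_sqr_sum.
- by move=> x _; rewrite lee_fin lerDr sqr_ge0.
Qed.

Lemma L2_measurable f : L2 f -> measurable_complex f.
Proof.
move=> [fRe fIm]; move: fRe; rewrite inE => /andP[/[!inE]/= mRe _].
by move: fIm; rewrite inE => /andP[/[!inE]/= mIm _].
Qed.

Lemma measurable_complexB f g : measurable_complex f -> measurable_complex g ->
  measurable_complex (fun x => f x - g x).
Proof.
move=> [mRf mIf] [mRg mIg]; split; under eq_fun do rewrite raddfB /=;
  exact: measurable_funB.
Qed.

(** The difference of the two sides is ((1 + e) p - q)^2 / e. *)
Lemma sqr_le_split (p q e : R) : 0 < e ->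
  q ^+ 2 <= (1 + e) * p ^+ 2 + (1 + e^-1) * (p - q) ^+ 2.
Proof.
move=> e0; rewrite -subr_ge0.
have -> : (1 + e) * p ^+ 2 + (1 + e^-1) * (p - q) ^+ 2 - q ^+ 2 =
    e^-1 * ((1 + e) * p - q) ^+ 2 by field; rewrite gt_eqF.
by rewrite mulr_ge0 ?sqr_ge0// invr_ge0 ltW.
Qed.

(** A quadratic form of the triangle inequality, which avoids square roots; the
constant 1 + e is removed at the end by [ler_scaled]. *)
Lemma energy_split f g e : measurable_complex f -> measurable_complex g ->
  0 < e -> (energy g <= (1 + e)%:E * energy f +
            (1 + e^-1)%:E * energy (fun x => (f x - g x)%R))%E.
Proof.
move=> mf mg e0; have [mRd mId] := measurable_complexB mf mg.
case: mf mg => [mRf mIf] [mRg mIg].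
have e1 : 0 <= 1 + e by rewrite addr_ge0// ltW.
have e2 : 0 <= 1 + e^-1 by rewrite addr_ge0// invr_ge0 ltW.
have sq0 (h : R -> R[i]) x :
    (0 <= (complex.Re (h x) ^+ 2 + complex.Im (h x) ^+ 2)%:E)%E.
  by rewrite lee_fin addr_ge0 ?sqr_ge0.
have sq0d (x : R) (_ : [set: R] x) := sq0 (fun x => f x - g x) x.
rewrite /energy -!ge0_integralZl ?lee_fin//; try exact: measurable_sqr_sum;
  try exact: sq0d.
rewrite -ge0_integralD//; last 4 first.
- by move=> x _; apply: mule_ge0; [rewrite lee_fin|exact: sq0].
- by apply: measurable_funeM; exact: measurable_sqr_sum.
- by move=> x _; apply: mule_ge0; [rewrite lee_fin|exact: sq0d].
- by apply: measurable_funeM; exact: measurable_sqr_sum.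
apply: ge0_le_integral => //.
- exact: measurable_sqr_sum.
- by apply: emeasurable_funD; apply: measurable_funeM; exact: measurable_sqr_sum.
move=> x _; rewrite -!EFinM -EFinD lee_fin !raddfB /=.
have := sqr_le_split (complex.Re (f x)) (complex.Re (g x)) e0.
have := sqr_le_split (complex.Im (f x)) (complex.Im (g x)) e0.
by lra.
Qed.

Lemma ler_scaled (X Y : R) : 0 <= X ->
  (forall e, 0 < e -> Y <= (1 + e) * X) -> Y <= X.
Proof.
move=> X0 YX; apply/ler_addgt0Pr => d d0.
have X1 : 0 < X + 1 by rewrite ltr_wpDl.
apply: le_trans (YX (d / (X + 1)) (divr_gt0 d0 X1)) _.
rewrite mulrDl mul1r lerD2l mulrAC ler_pdivrMr// ler_pM2l//.
by rewrite lerDl.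
Qed.

Lemma energyBC f g : energy (fun x => f x - g x) = energy (fun x => g x - f x).
Proof.
by apply: eq_integral => x _; rewrite -(opprB (g x)) !raddfN /= !sqrrN.
Qed.

Lemma energy_eq f g : measurable_complex f -> measurable_complex g ->
  energy f \is a fin_num -> energy g \is a fin_num ->
  energy (fun x => f x - g x) = 0%E -> energy f = energy g.
Proof.
move=> mf mg ff gf fg0.
have half (u v : R -> R[i]) : measurable_complex u -> measurable_complex v ->
    energy u \is a fin_num -> energy v \is a fin_num ->
    energy (fun x => u x - v x) = 0%E -> fine (energy v) <= fine (energy u).
  move=> mu' mv uf vf uv0; apply: ler_scaled => [|e e0].
    by rewrite fine_ge0// energy_ge0.
  have := energy_split mu' mv e0; rewrite uv0 mule0 adde0.
  by rewrite -(fineK uf) -(fineK vf) -EFinM lee_fin.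
rewrite -(fineK ff) -(fineK gf); congr EFin; apply/eqP; rewrite eq_le.
by rewrite !half// energyBC.
Qed.

Lemma L2_energy_fin f : L2 f -> energy f \is a fin_num.
Proof.
move=> [fRe fIm]; rewrite ge0_fin_numE ?energy_ge0// /energy.
have iRe := Lfun2_integrable_sqr fRe; have iIm := Lfun2_integrable_sqr fIm.
by have /integrable_lty := integrableD measurableT iRe iIm; exact.
Qed.

Lemma L2norm_le f e : 0 <= e -> (energy f <= (e ^+ 2)%:E)%E ->
  (L2norm f <= e%:E)%E.
Proof.
move=> e0; rewrite -L2norm_sqr; have := L2norm_ge0 f.
case: (L2norm f) => [r| |//] r0; last by rewrite expe2 mulyy.
by rewrite -EFin_expe !lee_fin ler_sqr ?nnegrE -?lee_fin.
Qed.
End Energy.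

(** * The Riesz constants *)

Section RieszBounds.
Variable R : realType.
Variable sigma : R.
Hypothesis sigma_gt0 : 0 < sigma.
Let A : R := sigma ^+ 2 * pi ^+ 2 / sinh (2 * sigma * pi).
Let B : R := A * cosh (2 * sigma * pi).
Implicit Types (c : int -> R[i]) (s : seq int).

Let A_gt0 : 0 < A := lower_constant_gt0 sigma_gt0.

Lemma upper_constant_gt0 : 0 < B.
Proof.
rewrite mulr_gt0// (lt_le_trans ltr01)// cosh_ge1// mulr_ge0 ?pi_ge0//.
by rewrite mulr_ge0// ltW.
Qed.

Let B_gt0 : 0 < B := upper_constant_gt0.

Lemma measurable_shift_comb s c : measurable_complex (shift_comb sigma s c).
Proof.
by split; under eq_fun do rewrite shift_combE /=;
  exact: measurable_lorentz_comb.
Qed.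

Lemma L2_lorentz_shift k : L2 (lorentz_shifts sigma k).
Proof.
have -> : lorentz_shifts sigma k = shift_comb sigma [:: k] (fun=> 1).
  by apply/funext => x; rewrite /shift_comb big_seq1 mul1r.
apply: L2_of_energy; first exact: measurable_shift_comb.
by rewrite energy_shift_comb// ltry.
Qed.

(** From r^2 <= E follows |r| <= 1 + E. *)
Lemma ell2_bounded c : ell2 c -> exists M, forall k,
  `|complex.Re (c k)| <= M /\ `|complex.Im (c k)| <= M.
Proof.
move=> c2; set E := fine (sqnorm_ell2 c).
have E0 : 0 <= E by rewrite fine_ge0// sqnorm_ge0.
have small (r : R) : r ^+ 2 <= E -> `|r| <= 1 + E.
  rewrite -real_normK ?num_real//; have := normr_ge0 r; set t := `|r| => t0 tE.
  by nra.
exists (1 + E) => k.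
have : ((mass [:: k] c)%:E <= sqnorm_ell2 c)%E by exact: mass_le_sqnorm.
rewrite -(fineK (sqnorm_fin c2)) lee_fin /mass big_seq1 normc_sqr -/E => kE.
by split; apply: small; apply: le_trans kE; rewrite ?lerDl ?lerDr sqr_ge0.
Qed.

Definition lorentz_series c (x : R) : R[i] := Complex
  (limn (fun n => lorentz_comb sigma (window n n) (fun k => complex.Re (c k)) x))
  (limn (fun n => lorentz_comb sigma (window n n) (fun k => complex.Im (c k)) x)).

Lemma cvg_lorentz_series c x : ell2 c ->
  complex.Re (shift_comb sigma (window n n) c x) @[n --> \oo]
    --> complex.Re (lorentz_series c x) /\
  complex.Im (shift_comb sigma (window n n) c x) @[n --> \oo]
    --> complex.Im (lorentz_series c x).
Proof.
move=> /ell2_bounded[M cM].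
by split; under eq_cvg do rewrite shift_combE /=;
  apply: (@is_cvg_lorentz_comb _ _ sigma_gt0 _ M) => k; have [] := cM k.
Qed.

Lemma measurable_lorentz_series c : ell2 c ->
  measurable_complex (lorentz_series c).
Proof.
move=> c2; split.
- apply: (@measurable_fun_cvg _ _ _ _ (fun n x =>
    complex.Re (shift_comb sigma (window n n) c x))) => [n|x _].
    by have [] := measurable_shift_comb (window n n) c.
  by have [] := cvg_lorentz_series x c2.
- apply: (@measurable_fun_cvg _ _ _ _ (fun n x =>
    complex.Im (shift_comb sigma (window n n) c x))) => [n|x _].
    by have [] := measurable_shift_comb (window n n) c.
  by have [] := cvg_lorentz_series x c2.
Qed.

(** The function on the left is the pointwise limit of differences of partial
sums, which are finite combinations of shifts with coefficients outside the
window; the upper Gram bound and Fatou's lemma conclude. *)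
Lemma energy_tail c m n : ell2 c ->
  (energy (fun x => (lorentz_series c x - shift_comb sigma (window m n) c x)%R)
    <= (B * (fine (sqnorm_ell2 c) - mass (window m n) c))%:E)%E.
Proof.
move=> c2; set t := window m n.
pose g N x := shift_comb sigma (window N N) c x - shift_comb sigma t c x.
have mg N : measurable_complex (g N).
  exact: measurable_complexB (measurable_shift_comb _ _) (measurable_shift_comb _ _).
apply: (@energy_fatou _ g _ _ (maxn m n)) => [N|N|x|x|N].
- by have [] := mg N.
- by have [] := mg N.
- rewrite raddfB /=; under eq_cvg do rewrite /g raddfB /=.
  by apply: cvgB; [have [] := cvg_lorentz_series x c2|exact: cvg_cst].
- rewrite raddfB /=; under eq_cvg do rewrite /g raddfB /=.
  by apply: cvgB; [have [] := cvg_lorentz_series x c2|exact: cvg_cst].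
rewrite geq_max => /andP[mN nN].
have ts : {subset t <= window N N} by exact: window_sub.
have uN := uniq_window N N; have ut : uniq t := uniq_window m n.
pose d k := if k \in t then 0 else c k.
have -> : g N = shift_comb sigma (window N N) d.
  apply/funext => x; rewrite /g /shift_comb -sum_notin_uniq//.
  by apply: eq_bigr => k _; rewrite /d; case: ifP => // _; rewrite mul0r.
have /andP[_ /le_trans] := energy_shift_comb_bounds sigma_gt0 d uN; apply.
rewrite lee_fin -/A -/B ler_pM2l//.
have -> : mass (window N N) d = mass (window N N) c - mass t c.
  rewrite /mass -sum_notin_uniq//; apply: eq_bigr => k _.
  by rewrite /d; case: ifP => // _; rewrite ComplexField.Normc.normc0 expr0n.
by rewrite lerD2r -lee_fin fineK ?mass_le_sqnorm// sqnorm_fin.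
Qed.

(** The empty window in [energy_tail] gives the upper bound and large windows
the convergence; the lower bound passes to the limit by [energy_split]. *)
Lemma lorentz_riesz_bounds : riesz_bounds (lorentz_shifts sigma) A B.
Proof.
move=> c c2; set f := lorentz_series c.
set E := fine (sqnorm_ell2 c).
have EE : sqnorm_ell2 c = E%:E by rewrite fineK// sqnorm_fin.
have E0 : 0 <= E by rewrite fine_ge0// sqnorm_ge0.
have mf : measurable_complex f := measurable_lorentz_series c2.
have tail m n := energy_tail m n c2; rewrite -/E -/f in tail.
(* the partial sum over the empty window is 0 *)
have upper : (energy f <= (B * E)%:E)%E.
  have := tail 0 0; rewrite /mass big_nil subr0; congr (_ <= _)%E.
  congr energy; apply/funext => x.
  by rewrite /shift_comb big_nil subr0.
have ffin : energy f \is a fin_num.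
  by rewrite ge0_fin_numE ?energy_ge0// (le_lt_trans upper) ?ltry.
exists f; split.
- split; first by apply: L2_of_energy => //; rewrite (le_lt_trans upper) ?ltry.
  have small (e : R) : 0 < e -> \forall mn \near (\oo, \oo), (L2norm (fun x =>
      f x - partial_sum (lorentz_shifts sigma) c mn.1 mn.2 x)%R <= e%:E)%E.
    move=> e0; have e2 : 0 < e ^+ 2 / B by rewrite divr_gt0// exprn_gt0.
    (* a tail below e^2 / B has squared norm at most e^2 *)
    have [M MP] := mass_window_near c2 e2.
    exists ([set m | (M <= m)%N], [set n | (M <= n)%N]) => /=.
      by split; exists M.
    move=> [m n] /= [Mm Mn]; apply: L2norm_le; first exact: ltW.
    have -> : partial_sum (lorentz_shifts sigma) c m n =
        shift_comb sigma (window m n) c.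
      by apply/funext => x; exact: partial_sum_window.
    apply: (le_trans (tail m n)); rewrite lee_fin -ler_pdivlMl// mulrC.
    by have := MP m n Mm Mn; rewrite -/E; lra.
  apply/fine_cvgP; split.
    apply: filterS (small 1 ltr01) => mn le1.
    by rewrite ge0_fin_numE ?L2norm_ge0// (le_lt_trans le1) ?ltry.
  apply/cvgrPdist_le => e e0; apply: filterS (small e e0) => mn lee.
  have L0 := L2norm_ge0 (fun x =>
    f x - partial_sum (lorentz_shifts sigma) c mn.1 mn.2 x).
  rewrite sub0r normrN /= ger0_norm ?fine_ge0// -lee_fin fineK//.
  by rewrite ge0_fin_numE// (le_lt_trans lee) ?ltry.
- rewrite L2norm_sqr EE -(fineK ffin) -EFinM lee_fin.
  apply: ler_scaled => [|e e0]; first by rewrite fine_ge0// energy_ge0.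
  apply/ler_addgt0Pr => d d0.
  have e1 : 0 < 1 + e^-1 by rewrite addr_gt0// invr_gt0.
  have K0 : 0 < A + (1 + e^-1) * B by rewrite addr_gt0// mulr_gt0.
  have [M MP] := mass_window_near c2 (divr_gt0 d0 K0).
  have := MP M M (leqnn _) (leqnn _); set t := window M M; rewrite -/E => tE.
  have /andP[lo _] := energy_shift_comb_bounds sigma_gt0 c (uniq_window M M).
  (* A * mass t c <= (1 + e) * energy f + (1 + 1/e) * B * (E - mass t c),
     where t is so large that replacing mass t c by E in A * mass t c
     and dropping the last term costs at most d in total *)
  have := energy_split mf (measurable_shift_comb t c) e0.
  move=> /(le_trans lo); rewrite -(fineK ffin) => main.
  have := le_trans main (leeD2l _ (lee_wpmul2l _ (tail M M))).
  rewrite lee_fin (ltW e1) -!EFinM -EFinD lee_fin -/A -/t => /(_ erefl) fin.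
  have : A * (E - mass t c) + (1 + e^-1) * (B * (E - mass t c)) <= d.
    have -> : A * (E - mass t c) + (1 + e^-1) * (B * (E - mass t c)) =
        (A + (1 + e^-1) * B) * (E - mass t c) by ring.
    rewrite -ler_pdivlMl// mulrC; lra.
  lra.
- by rewrite L2norm_sqr EE -EFinM.
Qed.

(** The partial sums of a finitely supported sequence are eventually constant,
so the norm of their L2 limit is a value of the Toeplitz form. *)
Lemma finite_riesz_bounds A' B' N (a : int -> R) :
  riesz_bounds (lorentz_shifts sigma) A' B' -> (forall k, a k ^+ 2 = 1) ->
  A' * N%:R <= toeplitz (lorentz_gram sigma) (initial_ints N) a <= B' * N%:R.
Proof.
move=> bounds a1; pose t := window 0 N.
have ut : uniq t := uniq_window 0 N; have tE : t = initial_ints N by [].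
pose c k : R[i] := if k \in t then (a k)%:C%C else 0.
have cN : sqnorm_ell2 c = N%:R%:E.
  rewrite sqnorm_finite_support// /mass (eq_bigr (fun=> 1)) => [|k _].
    by rewrite tE big_map sumr_const_nat subn0.
  by rewrite normc_sqr /= a1 expr0n addr0.
have [|f [[f2 flim] lo up]] := bounds c; first by rewrite /ell2 /= cN ltry.
set S := shift_comb sigma t (fun k => (a k)%:C%C).
have SE m n : (N <= n)%N -> partial_sum (lorentz_shifts sigma) c m n = S.
  move=> Nn; apply/funext => x; rewrite partial_sum_window /S /shift_comb.
  have tsub : {subset t <= window m n} by exact: window_sub (leq0n m) Nn.
  rewrite -(sum_mem_uniq _ (uniq_window m n) ut tsub).
  by apply: eq_bigr => k _; rewrite /c; case: ifP => // _; rewrite mul0r.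
have energyS : energy S = (toeplitz (lorentz_gram sigma) (initial_ints N) a)%:E.
  rewrite energy_shift_comb//= tE.
  congr EFin; rewrite [X in _ + X]big1 ?addr0// => j _.
  by rewrite big1// => k _; rewrite !mul0r.
have f0 : L2norm (fun x => f x - S x) = 0%E.
  apply: (cvg_unique _ _ flim) => //; apply: cvg_near_cst.
  exists (setT, [set n | (N <= n)%N]) => /=; first by split; [exact: filterT|exists N].
  by move=> [m n] /= [_ Nn]; rewrite SE.
have fS : energy f = energy S.
  apply: energy_eq.
  - exact: L2_measurable.
  - exact: measurable_shift_comb.
  - exact: L2_energy_fin.
  - by rewrite energyS.
  - by rewrite -L2norm_sqr f0 expe2 mul0e.
by move: lo up; rewrite L2norm_sqr fS energyS cN -!EFinM !lee_fin => -> ->.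
Qed.

(** Divide by N and let N tend to infinity. *)
Lemma ler_of_asymptotic (x y : R) :
  (forall e, 0 < e -> exists C, forall N : nat,
    x * N%:R <= y * N%:R + (e * N%:R + C)) ->
  x <= y.
Proof.
move=> xy; apply/ler_addgt0Pr => e e0.
have [C CP] := xy _ (divr_gt0 e0 (ltr0Sn R 1)).
rewrite leNgt; apply/negP => yx.
have d0 : 0 < x - y - e / 2 by lra.
have := CP (Num.bound `|C / (x - y - e / 2)|).
set n := Num.bound _; have : C / (x - y - e / 2) < n%:R.
  exact: (le_lt_trans (ler_norm _) (archi_boundP (normr_ge0 _))).
rewrite ltr_pdivrMr//; lra.
Qed.

Lemma lower_constant_max A' B' :
  riesz_bounds (lorentz_shifts sigma) A' B' -> A' <= A.
Proof.
move=> bounds; apply: ler_of_asymptotic => e e0.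
have pi0 : (0 : R) <= 0 <= (pi : R) by apply/andP; split; [|exact: pi_ge0].
have [C CP] := lorentz_gram_sharp sigma_gt0 (sin0 R) pi0 e0.
exists C => N; have [a [a1]] := CP N; rewrite mulr0 cosh0 mulr1 -/A.
have /andP[lo _] := finite_riesz_bounds N bounds a1.
by rewrite ler_norml => /andP[_]; lra.
Qed.

Lemma upper_constant_min A' B' :
  riesz_bounds (lorentz_shifts sigma) A' B' -> B <= B'.
Proof.
move=> bounds; apply: ler_of_asymptotic => e e0.
have pi0 : (0 : R) <= pi <= (pi : R) by apply/andP; split; [exact: pi_ge0|].
have [C CP] := lorentz_gram_sharp sigma_gt0 (sinpi R) pi0 e0.
exists C => N; have [a [a1]] := CP N; rewrite -/A -/B.
have /andP[_ up] := finite_riesz_bounds N bounds a1.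
by rewrite ler_norml => /andP[+ _]; lra.
Qed.

End RieszBounds.

Theorem theorem1 (R : realType) (sigma : R) (sigma_gt0 : 0 < sigma) :
  [/\ riesz_system (lorentz_shifts sigma),
      is_lower_riesz_constant (lorentz_shifts sigma)
        (sigma ^+ 2 * pi ^+ 2 / sinh (2 * sigma * pi)) &
      is_upper_riesz_constant (lorentz_shifts sigma)
        (sigma ^+ 2 * pi ^+ 2 * cosh (2 * sigma * pi)
           / sinh (2 * sigma * pi))].
Proof.
have bounds := lorentz_riesz_bounds sigma_gt0.
have A0 := lower_constant_gt0 sigma_gt0; have B0 := upper_constant_gt0 sigma_gt0.
rewrite [X in is_upper_riesz_constant _ X]mulrAC; split.
- split; first exact: L2_lorentz_shift.
  by exists (sigma ^+ 2 * pi ^+ 2 / sinh (2 * sigma * pi));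
     exists (sigma ^+ 2 * pi ^+ 2 / sinh (2 * sigma * pi) * cosh (2 * sigma * pi)).
- split; first by split=> //; eexists; [exact: B0|].
  by move=> A' [_ [B' _]] /(lower_constant_max sigma_gt0).
- split; first by split=> //; eexists; [exact: A0|].
  by move=> B' [_ [A' _]] /(upper_constant_min sigma_gt0).
Qed.
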